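(* Let $m>1$ and let $(V_\delta,R_\delta,\sigma_\delta)_{0<\delta<1}$ be a high-energy family of solitary waves (as defined in the context) with associated parameters $\varepsilon_\delta,\mu_\delta$. Let $I_\delta:=[0,\tfrac{1}{2\mu_\delta}]$, $J_\delta:=[-\tfrac{1}{2\mu_\delta},\tfrac{1}{2\mu_\delta}]$ and $$\tilde S_\delta(\tilde x):=\frac{R_\delta(0)-R_\delta(\mu_\delta\tilde x)}{\varepsilon_\delta}=\frac{1-\varepsilon_\delta-R_\delta(\mu_\delta\tilde x)}{\varepsilon_\delta}.$$ Then each function $\tilde S_\delta$ is strictly increasing and convex on $I_\delta$. Moreover, there is a constant $C$ independent of $\delta$ such that for all $0<\delta<1$ $$\sup_{\tilde x\in J_\delta}\big|\tilde S_\delta(\tilde x)-\tilde S_0(\tilde x)\big|\le C\varepsilon_\delta^{m-1},\qquad \sup_{\tilde x\in J_\delta}\big|\tilde S_\delta'(\tilde x)-\tilde S_0'(\tilde x)\big|\le C\varepsilon_\delta^{m},\qquad \sup_{\tilde x\in J_\delta}\big|\tilde S_\delta''(\tilde x)-\tilde S_0''(\tilde x)\big|\le C\varepsilon_\delta^{m+1}.$$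
   Context: Fix $m\in(1,\infty)$ and $\Phi(r)=\frac{1}{m(m+1)}\big((1-r)^{-m}-mr-1\big)$ for $r<1$. For $V\in L^2(\mathbb R)$ let $(AV)(x)=\int_{x-1/2}^{x+1/2}V(y)\,dy$. A solitary wave is a triple $(V,R,\sigma)$ with $\sigma>0$ satisfying $R=AV$ and $\sigma V=A\Phi'(R)$ on $\mathbb R$ (equivalently, for $V\in L^2$, $R'(x)=V(x+\frac12)-V(x-\frac12)$ and $\sigma V'(x)=\Phi'(R(x+\frac12))-\Phi'(R(x-\frac12))$ for all $x\in\mathbb R$). A function is unimodal if it is increasing for negative $x$ and decreasing for positive $x$. A high-energy family is a family $(V_\delta,R_\delta,\sigma_\delta)_{0<\delta<1}$ of solitary waves such that (i) $V_\delta,R_\delta\in L^2(\mathbb R)\cap BC^1(\mathbb R)$ are nonnegative, even and unimodal; (ii) $\|V_\delta\|_2=1-\delta$ and $R_\delta$ takes values in $[0,1)$; (iii) $p_\delta:=\int_{\mathbb R}\Phi(R_\delta(x))\,dx\to+\infty$ as $\delta\to0$. Its parameters are $\varepsilon_\delta:=1-R_\delta(0)$ and $\mu_\delta:=\sqrt{\sigma_\delta\,\varepsilon_\delta^{m+2}}$. $\tilde S_0:\mathbb R\to\mathbb R$ is the solution of the initial value problem $\tilde S_0''=\frac{2}{m+1}\,(1+\tilde S_0)^{-(m+1)}$, $\tilde S_0(0)=\tilde S_0'(0)=0$. *)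

(* Defs.v *)
From HB Require Import structures.
From mathcomp Require Import all_boot all_order all_algebra.
From mathcomp Require Import all_classical all_reals all_analysis.

Set Implicit Arguments.
Unset Strict Implicit.
Unset Printing Implicit Defensive.

Import Order.TTheory GRing.Theory Num.Theory.
Import numFieldNormedType.Exports.

Local Open Scope ring_scope.
Local Open Scope classical_set_scope.

(* Only meaningful for r < 1. *)
Definition Phi (K : realType) (m r : K) : K :=
  (m * (m + 1))^-1 * ((1 - r) `^ (- m) - m * r - 1).

Definition avg (K : realType) (f : K -> K) (x : K) : K :=
  \int[lebesgue_measure]_(y in `[x - 2^-1, x + 2^-1]) f y.

Definition L2 (K : realType) (f : K -> K) : Prop :=
  f \in Lfun (@lebesgue_measure K) 2%:E.

Definition BC1 (K : realType) (f : K -> K) : Prop :=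
  [/\ forall x : K, derivable f x 1, continuous (f^`()),
      bounded_fun f & bounded_fun (f^`())].

(* Both monotonicities are non-strict. *)
Definition unimodal (K : realType) (f : K -> K) : Prop :=
  (forall x y : K, x <= y -> y < 0 -> f x <= f y) /\
  (forall x y : K, 0 < x -> x <= y -> f y <= f x).

(* R < 1 is the domain condition under which Phi'(R) makes sense. *)
Definition solitary_wave (K : realType) (m : K) (V R : K -> K) (sigma : K)
    : Prop :=
  [/\ L2 V, 0 < sigma, forall x : K, R x < 1,
      forall x : K, R x = avg V x
    & forall x : K, sigma * V x = avg (fun y => (Phi m)^`() (R y)) x].

Definition wave_shape (K : realType) (f : K -> K) : Prop :=
  [/\ L2 f, BC1 f, forall x : K, 0 <= f x, forall x : K, f (- x) = f x & unimodal f].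

(* The families are total functions of the parameter d; only their values
   for 0 < d < 1 are constrained. *)
Definition high_energy_family (K : realType) (m : K) (V R : K -> K -> K)
    (sigma : K -> K) : Prop :=
  [/\ forall d : K, 0 < d < 1 -> solitary_wave m (V d) (R d) (sigma d),
      forall d : K, 0 < d < 1 -> wave_shape (V d) /\ wave_shape (R d),
      forall d : K, 0 < d < 1 ->
        ('N[lebesgue_measure]_2%:E[EFin \o V d] = (1 - d)%:E)%E,
      forall d : K, 0 < d < 1 -> forall x : K, 0 <= R d x < 1
    & (\int[lebesgue_measure]_x (Phi m (R d x))%:E)%E @[d --> 0^'+] --> +oo%E].

Definition amplitude_gap (K : realType) (R : K -> K) : K := 1 - R 0.

Definition scale (K : realType) (m : K) (R : K -> K) (sigma : K) : K :=
  Num.sqrt (sigma * amplitude_gap R `^ (m + 2)).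

Definition rescaled (K : realType) (m : K) (R : K -> K) (sigma : K) (x : K)
    : K :=
  (R 0 - R (scale m R sigma * x)) / amplitude_gap R.

(* Positivity of 1 + S keeps the solution in the domain of the right-hand side
   (powR takes a conventional value on negative bases). *)
Definition limit_ivp (K : realType) (m : K) (S : K -> K) : Prop :=
  [/\ forall x : K, derivable S x 1, forall x : K, derivable (S^`()) x 1,
      forall x : K, 0 < 1 + S x,
      forall x : K, S^`()^`() x = 2 / (m + 1) * (1 + S x) `^ (- (m + 1))
    & S 0 = 0 /\ S^`() 0 = 0].

Definition sup_dist (K : realType) (D : set K) (f g : K -> K) : \bar K :=
  ereal_sup [set `|f x - g x|%:E | x in D].

(* Main.v *)
Require Import Defs.
From HB Require Import structures.
From mathcomp Require Import all_boot all_order all_algebra ring lra.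
From mathcomp Require Import all_classical all_reals all_analysis.

Set Implicit Arguments.
Unset Strict Implicit.
Unset Printing Implicit Defensive.

Import Order.TTheory GRing.Theory Num.Theory.
Import numFieldNormedType.Exports.

Local Open Scope ring_scope.
Local Open Scope classical_set_scope.

(** Write [1 - R (mu x) = eps (1 + u x)] for the rescaled profile [u]. The wave
equations give [u'' = g u - h] with [g u = 2/(m+1) (1 + u)^-(m+1)], where the
defect [h] collects the values of [Phi' o R] at distance 1 and is of order
[eps^(m+1)], because [R 1/2 <= 3/4] by Cauchy-Schwarz and the norm constraint.
The bound [u x <= x^2 / 2] shows that [R] stays close to its maximum on an
interval of length comparable to [mu], which bounds [sigma] from below and gives
[eps = O(mu)]; hence the window has length [O(1 / eps)]. Both [u] and [S0] grow at
least linearly, so [w = u - S0] satisfies [|w''| <= Q (1 + x)^-3 |w| + O(eps^(m+1))],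
and the integrable weight yields [|w'| = O(eps^(m+1) (1 + x))] by a Gronwall
argument. *)

(** The linear growth of [u] requires a small defect, hence a small gap, whereas the estimates
    concern every delta. A threshold [small_gap] depending on [m] alone separates two regimes. Below
    it the profile equation forces the growth. Above it [sigma >= 1 / (4 (m + 1))] keeps [mu] away
    from 0, so the window is bounded and the trivial bound [1 + u >= 1] already counts as linear
    growth. There is no circularity: [u <= x^2 / 2] is obtained with no lower bound on [mu], and
    only afterwards used to derive one. The three exponents reflect two integrations: the second
    derivatives differ by O(eps^(m+1)), and each integration over a window of length O(1 / eps)
    costs one factor eps. *)

(** * Elementary calculus on the real line *)

Section Calculus.
Context {K : realType}.
Implicit Types (f g df dg : K -> K) (a b c d x y : K).

Lemma is_derive_continuous f d x : is_derive x 1 f d -> {for x, continuous f}.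
Proof. by case=> dfx _; apply/differentiable_continuous/derivable1_diffP. Qed.

Lemma is_derive_within_continuous f df a b :
  (forall x, a <= x <= b -> is_derive x 1 f (df x)) ->
  {within `[a, b], continuous f}.
Proof.
move=> fdf; apply: derivable_within_continuous => x; rewrite in_itv/= => xab.
by case: (fdf _ xab).
Qed.

(** The mean value theorem for g - f. It stands in for the integration of inequalities
    throughout. *)
Lemma increment_le f df g dg a b : a <= b ->
  (forall x, a <= x <= b -> is_derive x 1 f (df x)) ->
  (forall x, a <= x <= b -> is_derive x 1 g (dg x)) ->
  (forall x, a <= x <= b -> df x <= dg x) ->
  f b - f a <= g b - g a.
Proof.
move=> ab fdf gdg le_d.
have hd x : a <= x <= b -> is_derive x 1 (g \- f) (dg x - df x).
  by move=> xab; apply: is_deriveB; [exact: gdg|exact: fdf].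
have hd_oo x : x \in `]a, b[%R -> is_derive x 1 (g \- f) (dg x - df x).
  by rewrite in_itv/= => /andP[? ?]; apply: hd; rewrite !ltW.
have [c] := MVT_segment ab hd_oo (is_derive_within_continuous hd).
rewrite in_itv/= => cab /= E.
have : 0 <= (dg c - df c) * (b - a).
  by rewrite mulr_ge0// subr_ge0// le_d.
rewrite -E; lra.
Qed.

Lemma increment_ge0 f df a b : a <= b ->
  (forall x, a <= x <= b -> is_derive x 1 f (df x)) ->
  (forall x, a <= x <= b -> 0 <= df x) -> f a <= f b.
Proof.
move=> ab fdf df0; rewrite -subr_ge0.
have := increment_le (f := cst 0) (df := cst 0) ab _ fdf df0.
by rewrite subrr; apply => x _; exact: is_derive_cst.
Qed.

Lemma is_derive_linear a x : is_derive x 1 (fun y => a * y) a.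
Proof.
have := is_deriveZ a (is_derive_id x 1).
by rewrite -[_ *: 1]/(_ * _) mulr1.
Qed.

Lemma is_derive_half_sqr a x : is_derive x 1 (fun y => a * (y ^+ 2 / 2)) (a * x).
Proof.
have -> : (fun y => a * (y ^+ 2 / 2)) = (a / 2) *: (id * id : K -> K).
  by apply/funext => y; rewrite expr2 mulrA mulrAC.
apply: is_derive_eq; rewrite -![_ *: _]/(_ * _); lra.
Qed.

Lemma increment_norm_le f df g dg a b : a <= b ->
  (forall x, a <= x <= b -> is_derive x 1 f (df x)) ->
  (forall x, a <= x <= b -> is_derive x 1 g (dg x)) ->
  (forall x, a <= x <= b -> `|df x| <= dg x) ->
  `|f b - f a| <= g b - g a.
Proof.
move=> ab fdf gdg le_d.
have le1 := increment_le ab fdf gdg (fun x xab => le_trans (ler_norm _) (le_d x xab)).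
have fdfN x : a <= x <= b -> is_derive x 1 (\- f) (- df x).
  by move=> xab; apply: is_deriveN; exact: fdf.
have le2 : - f b - - f a <= g b - g a.
  apply: (increment_le ab fdfN gdg) => x xab.
  by apply: le_trans (le_d x xab); rewrite -normrN ler_norm.
rewrite ler_norml; apply/andP; split; lra.
Qed.

(** The derivative is monotone, so on either side of z the increment of f is compared with that of
    the line of slope [df z]. *)
Lemma tangent_le f df ddf a b x z :
  (forall x, a <= x <= b -> is_derive x 1 f (df x)) ->
  (forall x, a <= x <= b -> is_derive x 1 df (ddf x)) ->
  (forall x, a <= x <= b -> 0 <= ddf x) ->
  a <= x <= b -> a <= z <= b -> df z * (x - z) <= f x - f z.
Proof.
move=> fdf dfddf ddf0 /andP[ax xb] /andP[az zb].
have df_le s t : a <= s -> s <= t -> t <= b -> df s <= df t.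
  move=> sa st tb; apply: (increment_ge0 st (df := ddf)) => y /andP[sy yt];
    [apply: dfddf | apply: ddf0]; by rewrite (le_trans sa)// (le_trans yt).
have [xz|/ltW zx] := leP x z.
  have := increment_le xz (f := f) (df := df) (fun=> _) (fun y _ => is_derive_linear (df z) y).
  rewrite -mulrBr => h; suff : f z - f x <= df z * (z - x) by lra.
  by apply: h => y /andP[xy yz]; [apply: fdf|apply: df_le => //];
    rewrite (le_trans ax)//; apply: le_trans zb.
rewrite mulrBr; apply: (increment_le zx (fun y _ => is_derive_linear (df z) y) (dg := df)).
  by move=> y /andP[zy yx]; apply: fdf; rewrite (le_trans az)// (le_trans yx).
by move=> y /andP[zy yx]; apply: df_le => //; apply: le_trans xb.
Qed.

Lemma derive2_convex_function f df ddf a b :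
  (forall x, a <= x <= b -> is_derive x 1 f (df x)) ->
  (forall x, a <= x <= b -> is_derive x 1 df (ddf x)) ->
  (forall x, a <= x <= b -> 0 <= ddf x) ->
  convex_function (`[a, b] : set K) f.
Proof.
move=> fdf dfddf ddf0 t x y; rewrite !inE/= !in_itv/= => xab yab.
have [t0 t1] : 0 <= t%:num /\ t%:num <= 1 by [].
rewrite !convRE; set s := t%:num in t0 t1 *.
have /andP[ax xb] := xab; have /andP[ay yb] := yab.
pose z : K := s * x + (1 - s) * y.
have zab : a <= z <= b by rewrite /z; apply/andP; split; nra.
have h1 := tangent_le fdf dfddf ddf0 xab zab.
have h2 := tangent_le fdf dfddf ddf0 yab zab.
rewrite -/z -subr_ge0.
(* The tangent terms cancel because s (x - z) + (1 - s) (y - z) = 0. *)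
have -> : s * f x + (1 - s) * f y - f z =
    s * (f x - f z - df z * (x - z)) + (1 - s) * (f y - f z - df z * (y - z)).
  by rewrite /z; ring.
by rewrite addr_ge0// mulr_ge0// subr_ge0.
Qed.

Lemma is_derive_shift f d b x :
  is_derive (x + b) 1 f d -> is_derive x 1 (fun y => f (y + b)) d.
Proof.
move=> fdf; have sd : is_derive x 1 (fun y => y + b) 1.
  by rewrite -[X in is_derive _ _ _ X]addr0; apply: is_deriveD.
by have := is_derive1_comp (g := fun y => y + b) fdf sd; rewrite mulr1.
Qed.

Lemma is_derive_scale f d c x :
  is_derive (c * x) 1 f d -> is_derive x 1 (fun y => f (c * y)) (c * d).
Proof.
move=> fdf; have sd : is_derive x 1 (fun y => c * y) c.
  exact: is_derive_linear.
by have := is_derive1_comp (g := fun y => c * y) fdf sd; rewrite mulrC.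
Qed.

Lemma derive1_reflect f x : (forall y, derivable f y 1) ->
  is_derive x 1 (fun y => f (- y)) (- derive1 f (- x)).
Proof.
move=> df_; have fd : is_derive (-1 * x) 1 f (derive1 f (- x)).
  by rewrite mulN1r; apply: DeriveDef (df_ _) _; rewrite derive1E.
rewrite -mulN1r (_ : (fun y => _) = (fun y => f (-1 * y))); last first.
  by apply/funext => y; rewrite mulN1r.
exact: is_derive_scale.
Qed.

Lemma locally_constant_derive f d k a b x :
  (forall y, a < y < b -> f y = k) -> a < x < b -> is_derive x 1 f d -> d = 0.
Proof.
move=> fk /andP[ax xb] fd.
have dk : is_derive x 1 (cst k) d.
  apply: near_eq_is_derive fd; near=> y; apply: fk; apply/andP; split; near: y.
    exact: lt_nbhsr.
  exact: lt_nbhsl.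
by rewrite -(@derive_val _ _ _ _ _ _ _ dk) derive_cst.
Unshelve. all: by end_near. Qed.

Lemma continuous_itv_integrable f a b : continuous f ->
  (@lebesgue_measure K).-integrable `[a, b] (EFin \o f).
Proof.
move=> cf; apply: continuous_compact_integrable; first exact: segment_compact.
exact: continuous_subspaceT.
Qed.

(** The fundamental theorem of calculus starts from a fixed left end a. Around each x the global
    function F agrees, up to a constant, with the integral from some a below both 0 and x. *)
Lemma antiderivative f : continuous f ->
  exists2 F : K -> K, (forall x, is_derive x 1 F (f x)) &
    forall x y, x < y -> \int[lebesgue_measure]_(t in `[x, y]) f t = F y - F x.
Proof.
move=> cf; pose J a x : K := \int[lebesgue_measure]_(t in `[a, x]) f t.
have JD a x y : a <= x <= y -> J a y = J a x + J x y.
  move=> /andP[ax xy].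
  rewrite /J -(Rintegral_itv_obnd_cbnd (r := x)).
    rewrite -(@Rintegral_itvB _ _ (BLeft a) (BRight y) x) ?bnd_simp//.
      by rewrite addrC subrK.
    exact: continuous_itv_integrable.
  apply: integrableS (continuous_itv_integrable x y cf) => //.
  by apply: subset_itvr; rewrite bnd_simp.
have J0 a b : b <= a -> J a b = 0.
  rewrite le_eqVlt => /predU1P[->|ba]; last first.
    by rewrite /J set_itv_ge ?Rintegral_set0// bnd_simp -ltNge.
  by rewrite /J set_itv1 Rintegral_set1.
(* The oriented integral from 0 to x: integrals over reversed segments vanish, so at most one term
   is nonzero. *)
pose F x := J 0 x - J x 0.
have FE a x : a < 0 -> a < x -> F x = J a x - J a 0.
  move=> a0 ax; rewrite /F; have [x0|x0] := leP 0 x.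
    by rewrite (J0 x)// (JD a 0 x) ?x0 ?(ltW a0)//; lra.
  by rewrite (J0 0 x) ?(ltW x0)// (JD a x 0) ?ltW//; lra.
exists F => [x|x y xy]; last first.
  pose a := Num.min 0 x - 1.
have [m0 mx] : Num.min 0 x <= 0 /\ Num.min 0 x <= x by rewrite !ge_min !lexx orbT.
have a0 : a < 0 by rewrite /a; lra.
  have ax : a < x by rewrite /a; lra.
  rewrite -/(J x y) (FE a y a0 (lt_trans ax xy)) (FE a x a0 ax).
  by rewrite (JD a x y) ?(ltW ax) ?(ltW xy)//; lra.
pose a := Num.min 0 x - 1.
have [m0 mx] : Num.min 0 x <= 0 /\ Num.min 0 x <= x by rewrite !ge_min !lexx orbT.
have a0 : a < 0 by rewrite /a; lra.
have ax : a < x by rewrite /a; lra.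
have [dJ JE] := continuous_FTC1_closed (u := x + 1) (f := f) (a := a) (x := x)
  ltac:(lra) (continuous_itv_integrable _ _ cf) ax (cf x).
have dJ' : is_derive x 1 (fun y => J a y - J a 0) (f x).
  rewrite -[f x]subr0; apply: is_deriveB.
  by apply: DeriveDef dJ _; rewrite -derive1E.
apply: near_eq_is_derive dJ'; near=> y.
by rewrite (FE a)//; near: y; exact: lt_nbhsr.
Unshelve. all: by end_near. Qed.

End Calculus.

(** * A Gronwall estimate with an integrable weight *)

Section LinearComparison.
Context {K : realType}.
Variables (Q : K) (Q0 : 0 <= Q).

(* [B' = B * (1 / (1 + s) + Q / (1 + s)^2)]: [psi] absorbs the weight at the cost of a
   bounded factor, since [expR (- Q) <= psi <= 1]. *)
Let psi (s : K) : K := expR (- Q * (1 + s)^-1).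
Let B (s : K) : K := (1 + s) * psi s.

Let psi_le1 (s : K) : 0 <= s -> psi s <= 1.
Proof.
move=> s0; rewrite /psi -[leRHS]expR0 ler_expR mulNr oppr_le0 mulr_ge0//.
by rewrite invr_ge0 addr_ge0.
Qed.

Let psi_le (s t : K) : 0 <= s -> s <= t -> psi s <= psi t.
Proof.
move=> s0 st; rewrite /psi ler_expR !mulNr lerN2 ler_wpM2l// lef_pV2 ?posrE; lra.
Qed.

Let psi_ge (s : K) : 0 <= s -> expR (- Q) <= psi s.
Proof.
by move=> s0; have := psi_le (lexx 0) s0; rewrite /psi addr0 invr1 mulr1.
Qed.

Let B_gt0 (s : K) : 0 <= s -> 0 < B s.
Proof. by move=> s0; rewrite mulr_gt0 ?expR_gt0// ltr_pwDl. Qed.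

Let B_le (s t : K) : 0 <= s -> s <= t -> B s <= B t.
Proof.
move=> s0 st; rewrite /B ler_pM ?expR_ge0 ?psi_le//; lra.
Qed.

Let is_derive_B (s : K) : 0 <= s ->
  is_derive s 1 B (psi s * (1 + Q / (1 + s))).
Proof.
move=> s0; have s1 : 1 + s != 0 by apply/eqP; lra.
have d1 : is_derive s 1 (fun y : K => 1 + y) 1.
  by rewrite -[X in is_derive _ _ _ X]add0r; apply: is_deriveD.
have dV : is_derive s 1 (fun y : K => (1 + y)^-1) (- (1 + s) ^- 2).
  by apply: is_derive_eq (is_deriveV s1 d1) _; rewrite -[LHS]/(_ * _) mulr1.
have dp : is_derive s 1 psi (psi s * (Q * (1 + s) ^- 2)).
  have dQ := is_deriveZ (- Q) dV.
  apply: is_derive_eq (is_derive1_comp (is_derive_expR _) dQ) _.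
  by rewrite -[_ *: _]/(_ * _) mulrNN.
apply: is_derive_eq (is_deriveM d1 dp) _.
rewrite -![_ *: _]/(_ * _); field; exact: s1.
Qed.

(** Let N be the maximum of |dw| / B, attained at c. Integrating |dw| <= N B bounds w, hence ddw, in
    terms of N; integrating ddw up to c then bounds N by itself with a strict gain, which gives N <=
    exp(Q) eta. *)
Lemma linear_comparison (w dw ddw : K -> K) (eta X : K) : 0 <= X -> 0 <= eta ->
  (forall x, 0 <= x <= X -> is_derive x 1 w (dw x)) ->
  (forall x, 0 <= x <= X -> is_derive x 1 dw (ddw x)) ->
  w 0 = 0 -> dw 0 = 0 ->
  (forall x, 0 <= x <= X -> `|ddw x| <= Q / (1 + x) ^+ 3 * `|w x| + eta) ->
  forall x, 0 <= x <= X ->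
  [/\ `|w x| <= expR Q * eta * (1 + x) ^+ 2,
      `|dw x| <= expR Q * eta * (1 + x)
    & `|ddw x| <= (Q * expR Q + 1) * eta].
Proof.
move=> X0 eta0 wdw dwddw w0 dw0 ddw_le.
pose q x := `|dw x| / B x.
have cq : {within `[0, X], continuous q}.
  apply: continuous_in_subspaceT => x; rewrite inE/= in_itv/= => /andP[x0 xX].
  have x0X : 0 <= x <= X by rewrite x0.
  apply: (continuousM (s := fun y => `|dw y|) (t := fun y => (B y)^-1)).
    apply: continuous_comp; last exact: norm_continuous.
    exact: is_derive_continuous (dwddw _ x0X).
  apply: continuousV; first by rewrite gt_eqF ?B_gt0.
  exact: is_derive_continuous (is_derive_B x0).
have ne : `[0, X] !=set0 by exists 0; rewrite /= in_itv/= lexx.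
have [c] := compact_EVT_max ne (@segment_compact _ _ _) cq.
rewrite inE/= in_itv/= => cX qmax; have /andP[c0 cX'] := cX.
pose N := q c; have N0 : 0 <= N by rewrite divr_ge0// ltW// B_gt0.
have dwN s : 0 <= s <= X -> `|dw s| <= N * B s.
  move=> sX; have /andP[s0 _] := sX.
  by rewrite -ler_pdivrMr ?B_gt0// qmax// inE/= in_itv/=.
have wN s : 0 <= s <= X -> `|w s| <= N * B s * s.
  move=> sX; have /andP[s0 sX'] := sX.
  have sub t : 0 <= t <= s -> 0 <= t <= X.
    by move=> /andP[-> ts]; rewrite (le_trans ts).
  have dlin t (_ : 0 <= t <= s) := is_derive_linear (N * B s) t.
  have := increment_norm_le s0 (fun t ts => wdw t (sub t ts)) dlin.
  rewrite w0 mulr0 !subr0; apply => t /[dup] /sub tX /andP[t0 ts].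
  by rewrite (le_trans (dwN _ tX))// ler_wpM2l// B_le.
have Nle : N <= expR Q * eta.
  (* The derivative of G dominates |ddw|. In |dw c| <= G c - G 0 the term N B(c) cancels, leaving N
     exp(-Q) (1 + c) <= eta c. *)
  pose G s := N * B s + (eta - N * expR (- Q)) * s.
  have sub t : 0 <= t <= c -> 0 <= t <= X.
    by move=> /andP[-> ts]; rewrite (le_trans ts).
  have dG s : 0 <= s <= c -> is_derive s 1 G
      (N * (psi s * (1 + Q / (1 + s))) + (eta - N * expR (- Q))).
    move=> /andP[s0 _]; apply: is_deriveD.
      exact: is_deriveZ (is_derive_B s0).
    exact: is_derive_linear.
  have := increment_norm_le c0 (fun t ts => dwddw t (sub t ts)) dG.
  rewrite dw0 subr0 /G mulr0 addr0.
  have -> : `|dw c| = N * B c by rewrite /N /q divfK// gt_eqF ?B_gt0.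
  have -> : B 0 = expR (- Q) by rewrite /B /psi addr0 invr1 mulr1 mul1r.
  have step s : 0 <= s <= c ->
      `|ddw s| <= N * (psi s * (1 + Q / (1 + s))) + (eta - N * expR (- Q)).
    move=> /[dup] /sub sX /andP[s0 sc].
    apply: le_trans (ddw_le _ sX) _.
    have p1 : 0 < 1 + s by lra.
    (* The bound |w s| <= N psi(s) (1 + s)^2 uses up two of the three powers; what remains is the
       second summand of B'. *)
    have h1 : Q / (1 + s) ^+ 3 * `|w s| <= N * psi s * (Q / (1 + s)).
      apply: (@le_trans _ _ (Q / (1 + s) ^+ 3 * (N * psi s * (1 + s) ^+ 2))).
        apply: ler_wpM2l; first by rewrite divr_ge0// exprn_ge0// ltW.
        apply: (le_trans (wN _ sX)); rewrite /B.
        have -> : N * ((1 + s) * psi s) * s = N * psi s * ((1 + s) * s) by ring.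
        apply: ler_wpM2l; first by rewrite mulr_ge0 ?expR_ge0.
        by rewrite expr2 ler_pM2l//; lra.
      rewrite le_eqVlt; apply/orP; left; apply/eqP; field.
      by apply/eqP; lra.
    have h2 : N * expR (- Q) <= N * psi s by rewrite ler_wpM2l// psi_ge.
    by lra.
  move=> /(_ step) h.
  have e1 : expR Q * expR (- Q) = 1 by rewrite -expRD subrr expR0.
  have : N * expR (- Q) <= eta.
    rewrite -(ler_pM2r (_ : 0 < 1 + c)); last by lra.
    rewrite mulrDr mulr1; lra.
  by rewrite -(ler_pM2l (expR_gt0 Q)) mulrCA e1 mulr1.
move=> x xX; have /andP[x0 _] := xX.
have E0 : 0 <= expR Q * eta by rewrite mulr_ge0 ?expR_ge0.
have Bx : B x <= 1 + x by rewrite ler_piMr ?psi_le1 ?addr_ge0.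
have NB : N * B x <= expR Q * eta * (1 + x).
  rewrite ler_pM//; exact: ltW (B_gt0 x0).
have wle : `|w x| <= expR Q * eta * (1 + x) ^+ 2.
  apply: (le_trans (wN _ xX)).
  rewrite expr2 mulrA; apply: ler_pM => //; last by rewrite lerDr.
  by rewrite mulr_ge0// ltW// B_gt0.
split => //; first exact: le_trans (dwN _ xX) NB.
apply: (le_trans (ddw_le _ xX)); rewrite mulrDl mul1r lerD2r.
have p1 : 1 <= 1 + x by lra.
have p0 : 0 < 1 + x by lra.
rewrite -!mulrA ler_wpM2l//.
rewrite ler_pdivrMl ?exprn_gt0//.
apply: (le_trans wle); rewrite mulrC ler_wpM2r//.
by rewrite [leRHS]exprS ler_peMl// exprn_ge0// ltW.
Qed.

End LinearComparison.

(** * The profile equation and its perturbations *)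

Section Profile.
Context {K : realType}.
Variables (m : K) (m_gt1 : 1 < m).

Definition force (u : K) : K := 2 / (m + 1) * (1 + u) `^ (- (m + 1)).

Lemma powRN_le (a x y : K) : 0 <= a -> 0 < x -> x <= y -> y `^ (- a) <= x `^ (- a).
Proof.
move=> a0 x0 xy; have y0 := lt_le_trans x0 xy.
rewrite !powRN lef_pV2 ?posrE ?powR_gt0// ge0_ler_powR// ?nnegrE ltW//.
Qed.

Lemma force_gt0 u : 0 < 1 + u -> 0 < force u.
Proof.
have m1 := m_gt1.
move=> u0; rewrite mulr_gt0 ?powR_gt0// divr_gt0//; lra.
Qed.

Lemma force_le u v : 0 < 1 + u -> u <= v -> force v <= force u.
Proof.
have m1 := m_gt1.
move=> u0 uv; rewrite ler_wpM2l//; first by rewrite divr_ge0//; lra.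
by apply: powRN_le => //; lra.
Qed.

Lemma force_le1 u : 0 <= u -> force u <= 1.
Proof.
have m1 := m_gt1.
move=> u0; apply: (@le_trans _ _ (force 0)); first by apply: force_le; lra.
rewrite /force addr0 powR1 mulr1 ler_pdivrMr; lra.
Qed.

Lemma is_derive_force (u : K) : 0 < 1 + u ->
  is_derive u 1 force (- 2 * (1 + u) `^ (- (m + 2))).
Proof.
have m1 := m_gt1.
move=> u0; have d1 : is_derive u 1 (fun y : K => 1 + y) 1.
  by rewrite -[X in is_derive _ _ _ X]add0r; apply: is_deriveD.
have d2 := is_derive1_comp (g := fun y => 1 + y) (is_derive1_powR (- (m + 1)) u0) d1.
apply: is_derive_eq (is_deriveZ (2 / (m + 1)) d2) _.
rewrite -[LHS]/(_ * _) mulr1.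
have -> : - (m + 1) - 1 = - (m + 2) by ring.
by field; apply/eqP; lra.
Qed.

Lemma force_lipschitz (a u v : K) : 0 < a -> a <= 1 + u -> a <= 1 + v ->
  `|force u - force v| <= 2 * a `^ (- (m + 2)) * `|u - v|.
Proof.
have m1 := m_gt1.
move=> a0; wlog vu : u v / v <= u.
  move=> H au av; have [vu|uv] := leP v u; first exact: H.
  by rewrite distrC [X in _ * X]distrC; apply: H => //; exact: ltW.
move=> au av; rewrite (ger0_norm (_ : 0 <= u - v)) ?subr_ge0// mulrBr.
pose L := 2 * a `^ (- (m + 2)).
apply: (increment_norm_le vu _ (fun x _ => is_derive_linear L x)) => x /andP[vx xu].
  by apply: is_derive_force; lra.
rewrite normrM normrN (ger0_norm (powR_ge0 _ _)) ger0_norm//.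
by rewrite ler_wpM2l// powRN_le//; lra.
Qed.

Let c := force 2^-1 / 4.

(** Since force <= 1 on nonnegative arguments, u <= x^2 / 2 <= 1/2 on [0, 1]. There ddu >= a =
    force(1/2) / 2, as the defect takes at most half of force(1/2). Hence u(1) >= a / 2, and from 1
    on the slope stays at least a. The rate [c] is a / 2. *)
Lemma profile_lower_bound (u du ddu : K -> K) (X : K) : 0 <= X ->
  (forall x, 0 <= x <= X -> is_derive x 1 u (du x)) ->
  (forall x, 0 <= x <= X -> is_derive x 1 du (ddu x)) ->
  u 0 = 0 -> du 0 = 0 ->
  (forall x, 0 <= x <= X -> 0 <= ddu x) ->
  (forall x, 0 <= x <= X -> force (u x) - force 2^-1 / 2 <= ddu x <= force (u x)) ->
  forall x, 0 <= x <= X ->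
    [/\ 0 <= u x, u x <= x ^+ 2 / 2 & c * (1 + x) <= 1 + u x].
Proof.
move=> X0 udu duddu u0 du0 ddu0 ddu_bd.
have du_mono s t : 0 <= s -> s <= t -> t <= X -> du s <= du t.
  move=> s0 st tX; apply: (increment_ge0 st (df := ddu)) => x /andP[sx xt].
  - by apply: duddu; rewrite (le_trans s0)// (le_trans xt).
  - by apply: ddu0; rewrite (le_trans s0)// (le_trans xt).
have du_ge0 s : 0 <= s <= X -> 0 <= du s.
  by move=> /andP[s0 sX]; rewrite -du0 du_mono.
have u_ge0 s : 0 <= s <= X -> 0 <= u s.
  move=> /andP[s0 sX]; rewrite -u0.
  apply: (increment_ge0 s0 (df := du)) => x /andP[x0 xt].
  - by apply: udu; rewrite x0 (le_trans xt).
  - by apply: du_ge0; rewrite x0 (le_trans xt).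
have du_le s : 0 <= s <= X -> du s <= s.
  move=> /andP[s0 sX]; have := increment_le s0 (f := du) (df := ddu)
    (g := fun y => 1 * y) (dg := cst 1).
  rewrite du0 mulr0 mul1r !subr0; apply => x /andP[x0 xs].
  - by apply: duddu; rewrite x0 (le_trans xs).
  - exact: is_derive_linear.
  - have xX : 0 <= x <= X by rewrite x0 (le_trans xs).
    have /andP[_ /le_trans] := ddu_bd _ xX; apply; exact/force_le1/u_ge0.
have u_le s : 0 <= s <= X -> u s <= s ^+ 2 / 2.
  move=> /andP[s0 sX].
  have := increment_le s0 (f := u) (df := du)
    (g := fun y => 1 * (y ^+ 2 / 2)) (dg := fun y => 1 * y).
  rewrite u0 expr0n/= !mul0r !mul1r !subr0; apply => x /andP[x0 xs].
  - by apply: udu; rewrite x0 (le_trans xs).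
  - exact: is_derive_half_sqr.
  - by rewrite mul1r; apply: du_le; rewrite x0 (le_trans xs).
have f0 : 0 < force 2^-1 by apply: force_gt0; rewrite addr_gt0// invr_gt0.
have f1 : force 2^-1 <= 1 by apply: force_le1; rewrite invr_ge0.
move=> x xX; have /andP[x0 xX'] := xX.
have ux0 := u_ge0 _ xX; split => //; first exact: u_le.
have [x1|x1] := leP x 1.
  apply: (@le_trans _ _ (4^-1 * 2)); last by lra.
  by apply: ler_pM; rewrite /c; lra.
pose a := force 2^-1 / 2.
have du_lin s : 0 <= s <= 1 -> a * s <= du s.
  move=> /andP[s0 s1]; have := increment_le s0 (g := du) (dg := ddu)
    (f := fun y => a * y) (df := cst a).
  rewrite du0 mulr0 !subr0; apply => t /andP[t0 ts].
  - exact: is_derive_linear.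
  - by apply: duddu; rewrite t0; lra.
  - have tX : 0 <= t <= X by rewrite t0; lra.
    have /andP[/(le_trans _) h _] := ddu_bd _ tX; apply: h.
    have ut : u t <= 2^-1.
      apply: (le_trans (u_le _ tX)).
      rewrite ler_pdivrMr// mulVf// expr_le1//; lra.
    have : force 2^-1 <= force (u t).
      by apply: force_le => //; have := u_ge0 _ tX; lra.
    by rewrite /cst /a; lra.
have le01 : (0 : K) <= 1 by [].
have u1 : a / 2 <= u 1.
  have := increment_le le01 (g := u) (dg := du)
    (f := fun z => a * (z ^+ 2 / 2)) (df := fun y => a * y).
  rewrite u0 expr1n expr0n/= mul0r mulr0 mul1r !subr0; apply => t /andP[t0 t1].
  - exact: is_derive_half_sqr.
  - by apply: udu; rewrite t0; lra.
  - by apply: du_lin; rewrite t0.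
have ux : a * x - a * 1 <= u x - u 1.
  apply: (increment_le (ltW x1) (f := fun y => a * y) (df := cst a) (dg := du)) => t /andP[t1 tx].
  - exact: is_derive_linear.
  - by apply: udu; lra.
  - rewrite /cst -[a]mulr1; apply: (le_trans (du_lin 1 _)); first by rewrite lexx andbT.
    by apply: du_mono; lra.
have : 0 <= a / 2 * (x - 1).
  by rewrite mulr_ge0// ?divr_ge0// ?subr_ge0//; apply/ltW => //; rewrite /a; lra.
rewrite /c; have : a = force 2^-1 / 2 by [].
move: (force 2^-1) f0 f1 => F f0 f1 aE; nra.
Qed.

(** Both profiles lie above b (1 + x) - 1, so the Lipschitz constant of [force] between them decays
    in x and supplies the weight of the linear comparison. *)
Lemma profile_comparison (u du ddu v dv ddv : K -> K) (X b eta : K) :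
  0 <= X -> 0 < b -> 0 <= eta ->
  (forall x, 0 <= x <= X -> is_derive x 1 u (du x)) ->
  (forall x, 0 <= x <= X -> is_derive x 1 du (ddu x)) ->
  (forall x, 0 <= x <= X -> is_derive x 1 v (dv x)) ->
  (forall x, 0 <= x <= X -> is_derive x 1 dv (ddv x)) ->
  u 0 = v 0 -> du 0 = dv 0 ->
  (forall x, 0 <= x <= X -> b * (1 + x) <= 1 + u x) ->
  (forall x, 0 <= x <= X -> b * (1 + x) <= 1 + v x) ->
  (forall x, 0 <= x <= X -> `|ddu x - force (u x)| <= eta) ->
  (forall x, 0 <= x <= X -> ddv x = force (v x)) ->
  let Q := 2 * b `^ (- (m + 2)) in
  forall x, 0 <= x <= X ->
  [/\ `|u x - v x| <= expR Q * eta * (1 + x) ^+ 2,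
      `|du x - dv x| <= expR Q * eta * (1 + x)
    & `|ddu x - ddv x| <= (Q * expR Q + 1) * eta].
Proof.
have m1 := m_gt1.
move=> X0 b0 eta0 udu duddu vdv dvddv uv0 duv0 ub vb uE vE Q.
have Q0 : 0 <= Q by rewrite mulr_ge0 ?powR_ge0.
apply: (linear_comparison Q0 X0 eta0 (w := u \- v) (dw := du \- dv) (ddw := ddu \- ddv)).
- by move=> x xX; apply: is_deriveB; [exact: udu|exact: vdv].
- by move=> x xX; apply: is_deriveB; [exact: duddu|exact: dvddv].
- by rewrite /= uv0 subrr.
- by rewrite /= duv0 subrr.
move=> x xX /=; have /andP[x0 _] := xX.
have x1 : 1 <= 1 + x by lra.
have bx0 : 0 < b * (1 + x) by rewrite mulr_gt0//; lra.
rewrite (vE _ xX).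
have -> : ddu x - force (v x) = (force (u x) - force (v x)) + (ddu x - force (u x)) by ring.
apply: (le_trans (ler_normD _ _)); apply: lerD; last exact: uE.
apply: (le_trans (force_lipschitz bx0 (ub _ xX) (vb _ xX))).
apply: ler_wpM2r => //; rewrite powRM ?(ltW b0)//; last by lra.
rewrite mulrA; apply: ler_wpM2l => //; rewrite powRN lef_pV2 ?posrE ?powR_gt0 ?exprn_gt0//; try lra.
(* The decay exponent m + 2 exceeds 3 because m > 1, and 1 + x >= 1. *)
by rewrite -powR_mulrn ?ler_powR//; lra.
Qed.

(** The comparison is made for x >= 0. Applying it to the reflected solution covers x < 0 without
    proving S even, which would call for a uniqueness argument. *)
Lemma limit_ivp_reflect (S : K -> K) : limit_ivp m S ->
  [/\ limit_ivp m (fun x => S (- x)),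
      forall x, derive1 (fun y => S (- y)) x = - derive1 S (- x)
    & forall x, derive1 (derive1 (fun y => S (- y))) x = derive1 (derive1 S) (- x)].
Proof.
case=> dS ddS S_gt SE [S0 dS0].
have d1 (x : K) := derive1_reflect x dS.
have E1 x : derive1 (fun y => S (- y)) x = - derive1 S (- x).
  by rewrite derive1E (@derive_val _ _ _ _ _ _ _ (d1 x)).
have d2 (x : K) : is_derive x 1 (derive1 (fun y => S (- y))) (derive1 (derive1 S) (- x)).
  have -> : derive1 (fun y => S (- y)) = (fun y => - derive1 S (- y)) by exact/funext.
  by apply: is_derive_eq (is_deriveN (derive1_reflect x ddS)) _; rewrite opprK.
have E2 x : derive1 (derive1 (fun y => S (- y))) x = derive1 (derive1 S) (- x).
  by rewrite derive1E (@derive_val _ _ _ _ _ _ _ (d2 x)).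
split; [split|exact: E1|exact: E2].
- by move=> x; case: (d1 x).
- by move=> x; case: (d2 x).
- by move=> x; exact: S_gt.
- by move=> x; rewrite E2 SE.
- by rewrite E1 !oppr0 dS0 oppr0.
Qed.

End Profile.

(** * Moving averages and the derivative of the potential *)

Section AverageAndPotential.
Context {K : realType}.

(** Averages become increments of one function, so they are estimated by [increment_le]. *)
Lemma avg_increment (f : K -> K) : continuous f ->
  exists2 F : K -> K, (forall x : K, is_derive x 1 F (f x)) &
    forall x, avg f x = F (x + 2^-1) - F (x - 2^-1).
Proof.
move=> cf; have [F dF FE] := antiderivative cf.
by exists F => // x; rewrite /avg FE//; lra.
Qed.

Lemma is_derive_avg (f : K -> K) (x : K) : continuous f ->
  is_derive x 1 (avg f) (f (x + 2^-1) - f (x - 2^-1)).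
Proof.
move=> cf; have [F dF FE] := avg_increment cf.
have -> : avg f = (fun y => F (y + 2^-1)) - (fun y => F (y - 2^-1)).
  by apply/funext => y; rewrite FE.
apply: is_deriveB; apply: is_derive_shift; exact: dF.
Qed.

Lemma integral_sqr_le (f : K -> K) (N x y : K) : continuous f ->
  ('N[lebesgue_measure]_2%:E[EFin \o f] = N%:E)%E ->
  \int[lebesgue_measure]_(t in `[x, y]) (f t) ^+ 2 <= N ^+ 2.
Proof.
move=> cf fN.
have N0 : 0 <= N by rewrite -lee_fin -fN Lnorm_ge0.
have absE t : (`|(EFin \o f) t| `^ 2 = ((f t) ^+ 2)%:E)%E.

  by rewrite /= powR_mulrn// real_normK// num_real.
have := @powR_Lnorm _ _ _ (@lebesgue_measure K) (EFin \o f) 2 ltac:(by rewrite pnatr_eq0).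
rewrite fN poweR_EFin powR_mulrn// => NE.
have cf2 : continuous (fun t => (f t) ^+ 2).
  move=> t; rewrite (_ : (fun t => _) = f \* f); last by apply/funext => z; rewrite expr2.
  by apply: (continuousM (s := f) (t := f)); exact: cf.
rewrite /Rintegral -lee_fin fineK.
  rewrite NE; under [leRHS]eq_integral do rewrite absE.
  apply: ge0_subset_integral => //.
    apply/measurable_realfun.measurable_EFinP.
    exact: measurable_realfun.continuous_measurable_fun.
  by move=> t _; rewrite lee_fin sqr_ge0.
apply: integrable_fin_num => //.
exact: (continuous_itv_integrable _ _ cf2).
Qed.

Variables (m : K) (m_gt1 : 1 < m).

Definition dPhi (r : K) : K := ((1 - r) `^ (- (m + 1)) - 1) / (m + 1).

Lemma derive1_Phi (r : K) : r < 1 -> (Phi m)^`() r = dPhi r.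
Proof.
have m1 := m_gt1.
move=> r1; rewrite derive1E.
have r0 : 0 < 1 - r by lra.
have d1 : is_derive r 1 (fun y : K => 1 - y) (- 1).
  by rewrite -[X in is_derive _ _ _ X]add0r; apply: is_deriveB.
have d2 := is_derive1_comp (g := fun y => 1 - y) (is_derive1_powR (- m) r0) d1.
have d3 := is_deriveB (is_deriveB d2 (is_derive_linear m r)) (is_derive_cst (1 : K) r 1).
have /@derive_val -> := is_deriveZ (m * (m + 1))^-1 d3.
rewrite -[LHS]/(_ * _) /dPhi subr0.
have -> : - m - 1 = - (m + 1) by ring.
by field; apply/andP; split; apply/eqP; lra.
Qed.

Lemma continuous_dPhi (r : K) : r < 1 -> {for r, continuous dPhi}.
Proof.
have m1 := m_gt1.
move=> r1; have r0 : 0 < 1 - r by lra.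
have d1 : is_derive r 1 (fun y : K => 1 - y) (- 1).
  by rewrite -[X in is_derive _ _ _ X]add0r; apply: is_deriveB.
have d2 := is_derive1_comp (g := fun y => 1 - y) (is_derive1_powR (- (m + 1)) r0) d1.
have d3 := is_deriveB d2 (is_derive_cst (1 : K) r 1).
have d4 := is_deriveZ (m + 1)^-1 d3.
have -> : dPhi = (m + 1)^-1 *: ((fun x => x `^ (- (m + 1))) \o (fun y => 1 - y) - cst 1).
  by apply/funext => x; rewrite /dPhi mulrC.
exact: is_derive_continuous d4.
Qed.

Lemma dPhi_lt (r s : K) : r < s -> s < 1 -> dPhi r < dPhi s.
Proof.
have m1 := m_gt1.
move=> rs s1; rewrite ltr_pM2r ?invr_gt0; last by lra.
rewrite ltrD2r !powRN ltf_pV2 ?posrE ?powR_gt0//; try lra.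
by apply: gt0_ltr_powR; rewrite ?nnegrE; lra.
Qed.

Lemma dPhi_le (r s : K) : r <= s -> s < 1 -> dPhi r <= dPhi s.
Proof.
by rewrite le_eqVlt => /predU1P[->//|rs] s1; apply/ltW/dPhi_lt.
Qed.

(** Crude but linear in r: (1 - r)^-(m+1) >= (1 - r)^-1 >= 1 + r. The linearity is what later lets
    [R 0] cancel in the bound on sigma. *)
Lemma dPhi_ge (r : K) : 0 <= r -> r < 1 -> r / (m + 1) <= dPhi r.
Proof.
have m1 := m_gt1.
move=> r0 r1; rewrite ler_pM2r ?invr_gt0; last by lra.
have h0 : 0 < 1 - r by lra.
have h1 : (1 - r) `^ (m + 1) <= 1 - r.
  by apply: ge1r_powR; lra.
have h2 : (1 - r)^-1 <= (1 - r) `^ (- (m + 1)).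
  by rewrite powRN lef_pV2 ?posrE ?powR_gt0.
have h3 : 1 + r <= (1 - r)^-1.
  by rewrite -(ler_pM2l h0) divff ?gt_eqF//; nra.
lra.
Qed.

End AverageAndPotential.

(** * Constants depending on [m] alone *)

Section WaveConstants.
Context {K : realType} (m : K).

(* The second half of [force_defect] comes from [R 1/2 <= 3/4]. *)
Definition force_defect : K := 2 / (m + 1) + 2 * dPhi m (3 / 4).

(** The first entry gives 3/2 eps <= 1/2; the second keeps the defect below force(1/2) / 2, as
    required by [profile_lower_bound]. *)
Definition small_gap : K := Num.min 3^-1 (force m 2^-1 / (2 * force_defect)).

Definition small_gap_scale_rate : K := 2^-1 * (3 / 2) `^ (- (m + 1)) / (m + 1).

(** The value of [scale] with sigma and the gap replaced by their lower bounds 1 / (4 (m + 1)) and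
    [small_gap]. *)
Definition large_gap_scale : K := Num.sqrt (small_gap `^ (m + 2) / (4 * (m + 1))).

Definition scale_rate : K := Num.min small_gap_scale_rate large_gap_scale.

(** One entry per regime: the rate of [profile_lower_bound], and the inverse of a bound for 1 + x on
    the window when the gap is large. *)
Definition growth_rate : K :=
  Num.min (force m 2^-1 / 4) (1 + 1 / (2 * large_gap_scale))^-1.

Definition comparison_rate : K := 2 * growth_rate `^ (- (m + 2)).

Definition window_constant : K := 1 + 1 / (2 * scale_rate).

Definition error_constant : K :=
  let Q := comparison_rate in let D := window_constant in
  expR Q * force_defect * D ^+ 2 + expR Q * force_defect * D +
  (Q * expR Q + 1) * force_defect.

Hypothesis m_gt1 : 1 < m.

Lemma force_defect_gt0 : 0 < force_defect.
Proof.
have m1 := m_gt1.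
have h : 0 <= dPhi m (3 / 4).
  apply: (le_trans _ (dPhi_ge m_gt1 _ _)); [|lra|lra].
  by rewrite divr_ge0//; lra.
apply: ltr_pwDl; last by rewrite mulr_ge0.
by rewrite divr_gt0//; lra.
Qed.

Lemma force_half_gt0 : 0 < force m 2^-1.
Proof. by apply: force_gt0 => //; lra. Qed.

Lemma small_gap_gt0 : 0 < small_gap.
Proof.
rewrite lt_min invr_gt0 ltr0n/= divr_gt0 ?force_half_gt0//.
by rewrite mulr_gt0 ?force_defect_gt0.
Qed.

Lemma small_gap_scale_rate_gt0 : 0 < small_gap_scale_rate.
Proof.
have m1 := m_gt1.
apply: divr_gt0; last by lra.
by apply: mulr_gt0; rewrite ?powR_gt0.
Qed.

Lemma small_gap_scale_rate_le : small_gap_scale_rate <= 2^-1.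
Proof.
have m1 := m_gt1.
rewrite /small_gap_scale_rate ler_pdivrMr; last lra.
rewrite ler_pM2l ?invr_gt0//; apply: (@le_trans _ _ 1); last lra.
rewrite powRN invf_le1 ?powR_gt0//.
rewrite -[leLHS](powRr0 (3 / 2)) ler_powR//; lra.
Qed.

Lemma large_gap_scale_gt0 : 0 < large_gap_scale.
Proof.
have m1 := m_gt1.
rewrite sqrtr_gt0; apply: divr_gt0; last by lra.
by rewrite powR_gt0 ?small_gap_gt0.
Qed.

Lemma scale_rate_gt0 : 0 < scale_rate.
Proof. by rewrite lt_min small_gap_scale_rate_gt0 large_gap_scale_gt0. Qed.

Lemma growth_rate_gt0 : 0 < growth_rate.
Proof.
rewrite lt_min divr_gt0 ?force_half_gt0//= invr_gt0 addr_gt0//.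
by rewrite divr_gt0// mulr_gt0// large_gap_scale_gt0.
Qed.

End WaveConstants.

(** * A single solitary wave and its differential equations *)

Section Wave.
Context {K : realType}.
Variables (m : K) (m_gt1 : 1 < m) (V R : K -> K) (sigma N : K).
Hypothesis wave : solitary_wave m V R sigma.
Hypothesis shapeV : wave_shape V.
Hypothesis shapeR : wave_shape R.
Hypothesis normV : ('N[lebesgue_measure]_2%:E[EFin \o V] = N%:E)%E.
Hypothesis N_gt0 : 0 < N.
Hypothesis N_le1 : N <= 1.

Let phi := dPhi m.

Lemma sigma_gt0 : 0 < sigma. Proof. by case: wave. Qed.

Lemma wave_lt1 x : R x < 1. Proof. by case: wave. Qed.

Lemma wave_ge0 x : 0 <= R x. Proof. by case: shapeR. Qed.

Lemma waveN x : R (- x) = R x. Proof. by case: shapeR. Qed.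

Lemma continuous_velocity : continuous V.
Proof.
case: shapeV => _ [dV _ _ _] _ _ _ x.
by apply/differentiable_continuous/derivable1_diffP.
Qed.

Lemma is_derive_wave (x : K) : is_derive x 1 R (V (x + 2^-1) - V (x - 2^-1)).
Proof.
have -> : R = avg V by apply/funext => y; case: wave.
exact/is_derive_avg/continuous_velocity.
Qed.

Let continuous_phiR : continuous (phi \o R).
Proof.
move=> x; apply: continuous_comp.
  exact: is_derive_continuous (is_derive_wave x).
by apply: continuous_dPhi => //; exact: wave_lt1.
Qed.

Lemma velocity_avg x : sigma * V x = avg (phi \o R) x.
Proof.
have -> : avg (phi \o R) x = avg (fun y => (Phi m)^`() (R y)) x.
  congr avg; apply/funext => y /=; rewrite derive1_Phi//; exact: wave_lt1.
by case: wave.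
Qed.

Lemma is_derive_velocity (x : K) :
  is_derive x 1 V (sigma^-1 * (phi (R (x + 2^-1)) - phi (R (x - 2^-1)))).
Proof.
have s0 := sigma_gt0.
have -> : V = sigma^-1 *: avg (phi \o R).
  apply/funext => y; rewrite -[RHS]/(_ * _) -velocity_avg mulKf// gt_eqF//.
exact: is_deriveZ (is_derive_avg x continuous_phiR).
Qed.

Lemma is_derive2_wave (x : K) :
  is_derive x 1 (fun y => V (y + 2^-1) - V (y - 2^-1))
    (sigma^-1 * (phi (R (x + 1)) + phi (R (x - 1)) - 2 * phi (R x))).
Proof.
have h1 := is_derive_shift (is_derive_velocity (x + 2^-1)).
have h2 := is_derive_shift (is_derive_velocity (x - 2^-1)).
apply: is_derive_eq (is_deriveB h1 h2) _.
have -> : x + 2^-1 + 2^-1 = x + 1 by lra.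
have -> : x - 2^-1 - 2^-1 = x - 1 by lra.
by rewrite addrK subrK; ring.
Qed.

(** * Shape of the wave and strictness of its maximum *)

(** [unimodal] compares positive points only. The value at 0 is included by continuity: R 0 < R y
    would persist at small t > 0. *)
Lemma wave_noninc x y : 0 <= x -> x <= y -> R y <= R x.
Proof.
case: shapeR => _ _ _ _ [_ dec].
rewrite le_eqVlt => /predU1P[<- y0|x0 xy]; last exact: dec.
have [->//|yn0] := eqVneq y 0; have {y0 yn0}y0 : 0 < y by rewrite lt_def yn0.
rewrite leNgt; apply/negP => Rlt.
have cR := is_derive_continuous (is_derive_wave 0).
have near_lt : \forall t \near (0 : K)^'+, R t < R y.
  by apply: (cvgr_lt (R 0)) Rlt; exact: cvg_at_right_filter cR.
have [t [Rt t0 ty]] : exists t, [/\ R t < R y, 0 < t & t < y].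
  near (0 : K)^'+ => t; exists t; split.
  - by near: t.
  - by near: t; exact: nbhs_right_gt.
  - by near: t; exact: nbhs_right_lt.
by have := dec _ _ t0 (ltW ty); rewrite leNgt Rt.
Unshelve. all: by end_near. Qed.

Lemma wave_le_abs x y : 0 <= x -> x <= `|y| -> R y <= R x.
Proof.
move=> x0 xy; rewrite (_ : R y = R `|y|) ?wave_noninc//.
by case: (ger0P y) => _; rewrite ?waveN.
Qed.

Lemma wave_le_max x : R x <= R 0.
Proof. exact: (wave_le_abs (lexx 0) (normr_ge0 x)). Qed.

Lemma integral_velocity_sqr_le : exists2 G : K -> K,
  (forall x : K, is_derive x 1 G (V x ^+ 2)) & forall x y, x < y -> G y - G x <= N ^+ 2.
Proof.
have cV2 : continuous (fun t => (V t) ^+ 2).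
  move=> t; rewrite (_ : (fun t => _) = V \* V); last by apply/funext => z; rewrite expr2.
  by apply: (continuousM (s := V) (t := V)); exact: continuous_velocity.
have [G dG GE] := antiderivative cV2.
exists G => // x y xy; rewrite -GE//.
exact/integral_sqr_le/normV/continuous_velocity.
Qed.

(** The zero function contradicts N > 0; a nonzero constant violates the bound on the integral of
    V^2 over an interval of length (N^2 + 1) / k^2. *)
Lemma velocity_not_constant k : ~ (forall x, V x = k).
Proof.
move=> Vk; have [G dG GE] := integral_velocity_sqr_le.
have N0 : 0 <= N ^+ 2 by rewrite sqr_ge0.
have [k0|k0] := eqVneq k 0.
  have /eqP := normV; rewrite (@eq_Lnorm _ _ _ _ _ _ (cst 0%E)); last first.
    by move=> x /=; rewrite Vk k0.
  by rewrite Lnorm0 eqe ?pnatr_eq0// lt_eqF.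
have k2 : 0 < k ^+ 2 by rewrite exprn_even_gt0.
pose y := (N ^+ 2 + 1) / k ^+ 2.
have y0 : 0 < y by rewrite divr_gt0// ltr_wpDl.
have := increment_le (ltW y0) (f := fun z => k ^+ 2 * z) (df := cst (k ^+ 2))
  (fun x _ => is_derive_linear _ x) (fun x _ => dG x).
have -> : k ^+ 2 * y = N ^+ 2 + 1 by rewrite mulrC divfK// gt_eqF.
rewrite mulr0 subr0 => H.
have /H h : forall x, 0 <= x <= y -> cst (k ^+ 2) x <= V x ^+ 2 by move=> x _; rewrite Vk.
have := GE _ _ y0; lra.
Qed.

(* If [R] equals its maximum at [c], it does so on [-c, c], and [R'' = 0] at a
   point [x] there forces [R (x + 1)] to be maximal as well. *)
Lemma wave_plateau_extends c : 0 < c -> R c = R 0 -> R (c + 2^-1) = R 0.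
Proof.
move=> c0 Rc.
have flat y : - c < y < c -> R y = R 0.
  move=> yc; apply/le_anti; rewrite wave_le_max/= -Rc.
  have -> : R y = R `|y| by case: (ger0P y) => _; rewrite ?waveN.
  by apply: wave_noninc => //; rewrite ltW// ltr_norml.
have flat1 y : - c < y < c -> V (y + 2^-1) - V (y - 2^-1) = 0.
  by move=> yc; exact: locally_constant_derive flat yc (is_derive_wave y).
(* A point inside the plateau with x + 1 >= c + 1/2. *)
pose x := Num.max (c - 2^-1) 0.
have x0 : 0 <= x by rewrite le_max lexx orbT.
have xc : c - 2^-1 <= x by rewrite le_max lexx.
have xlt : - c < x < c by rewrite (lt_le_trans _ x0) ?oppr_lt0// gt_max c0 andbT; lra.
have := locally_constant_derive flat1 xlt (is_derive2_wave x).
move=> /eqP; rewrite mulf_eq0 invr_eq0 gt_eqF ?sigma_gt0//= => /eqP.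
rewrite (flat _ xlt).
have := dPhi_le m_gt1 (wave_le_max (x - 1)) (wave_lt1 0).
have := wave_le_max (x + 1); rewrite le_eqVlt => /predU1P[E _ _|lt1].
  apply/le_anti; rewrite wave_le_max/= -E wave_noninc//; lra.
have := dPhi_lt m_gt1 lt1 (wave_lt1 0); rewrite -/phi; lra.
Qed.

(** A second maximum point would create a plateau that grows by 1/2 at each step, so R, and with it
    V, would be constant. *)
Lemma wave_lt_max y : 0 < y -> R y < R 0.
Proof.
move=> y0; rewrite lt_neqAle wave_le_max andbT; apply/negP => /eqP Ry.
have Rn (n : nat) : R (y + n%:R / 2) = R 0.
  elim: n => [|n IH]; first by rewrite mul0r addr0.
  have -> : y + n.+1%:R / 2 = (y + n%:R / 2) + 2^-1 by rewrite -natr1; lra.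
  by apply: wave_plateau_extends => //; rewrite ltr_wpDr// divr_ge0.
have Rcst x : R x = R 0.
  apply/le_anti; rewrite wave_le_max/=.
  have -> : R x = R `|x| by case: (ger0P x) => _; rewrite ?waveN.
  have x2 : 0 <= 2 * `|x| by rewrite mulr_ge0.
  rewrite -(Rn (Num.bound (2 * `|x|))); apply: wave_noninc => //.
  by have := archi_boundP x2; lra.
apply: (@velocity_not_constant (sigma^-1 * phi (R 0))) => x.
have s0 := sigma_gt0.
rewrite -[LHS](mulKf (lt0r_neq0 s0)) velocity_avg; congr *%R.
have [P dP ->] := avg_increment continuous_phiR.
have xx : x - 2^-1 <= x + 2^-1 by lra.
have phi_le z : phi (R z) <= phi (R 0) by rewrite Rcst.
have phi_ge z : phi (R 0) <= phi (R z) by rewrite Rcst.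
have h1 := increment_le xx (fun z _ => dP z) (fun z _ => is_derive_linear (phi (R 0)) z).
have h2 := increment_le xx (fun z _ => is_derive_linear (phi (R 0)) z) (fun z _ => dP z).
have {}h1 := h1 (fun z _ => phi_le z).
have {}h2 := h2 (fun z _ => phi_ge z).
move: h1 h2; lra.
Qed.

Lemma wave0_gt0 : 0 < R 0.
Proof. exact: le_lt_trans (wave_ge0 1) (wave_lt_max ltr01). Qed.

Lemma amplitude_gap_gt0 : 0 < amplitude_gap R.
Proof. by rewrite subr_gt0 wave_lt1. Qed.

Lemma amplitude_gap_lt1 : amplitude_gap R < 1.
Proof. by have := wave0_gt0; rewrite /amplitude_gap; lra. Qed.

(** * Bounds on the wave at distance 1/2 and on sigma *)

(** For |x| <= 1/2 both x + 1 and x - 1 are at least as far from 0 as x. This fixes the half-width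
    1/2 of the window in the original variable. *)
Lemma wave_concave (x : K) : `|x| <= 2^-1 ->
  phi (R (x + 1)) + phi (R (x - 1)) <= 2 * phi (R x).
Proof.
move=> x2; have [xl xu] : - 2^-1 <= x /\ x <= 2^-1 by apply/andP; rewrite -ler_norml.
have aux y : 2^-1 <= `|y| -> R y <= R x.
  move=> hy; apply: (@le_trans _ _ (R 2^-1)).
    by apply: wave_le_abs => //; rewrite invr_ge0.
  have -> : R x = R `|x| by case: (ger0P x) => _; rewrite ?waveN.
  exact: wave_noninc.
have h1 : R (x + 1) <= R x by apply: aux; rewrite ger0_norm; lra.
have h2 : R (x - 1) <= R x by apply: aux; rewrite ler0_norm; lra.
have := dPhi_le m_gt1 h1 (wave_lt1 x); have := dPhi_le m_gt1 h2 (wave_lt1 x).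
by rewrite -/phi; lra.
Qed.

Let halves : (2^-1 : K) + 2^-1 = 1 /\ (2^-1 : K) - 2^-1 = 0 /\
  - (2^-1 : K) + 2^-1 = 0 /\ - (2^-1 : K) - 2^-1 = - 1.
Proof. by split; [lra|split; [lra|split; lra]]. Qed.

(** By evenness 2 R(1/2) is the integral of V over [-1, 1]. Cauchy-Schwarz enters in the pointwise
    form V <= V^2 + 1/4, giving 2 R(1/2) <= N^2 + 1/2. *)
Lemma wave_half_le : R 2^-1 <= 3 / 4.
Proof.
have [F dF FE] := avg_increment continuous_velocity.
have RF x : R x = F (x + 2^-1) - F (x - 2^-1) by rewrite -FE; case: wave.
have [G dG GE] := integral_velocity_sqr_le.
have le11 : (-1 : K) < 1 by lra.
have dG' (x : K) : is_derive x 1 (G \+ (fun y => 4^-1 * y)) (V x ^+ 2 + 4^-1).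
  exact: is_deriveD (dG x) (is_derive_linear 4^-1 x).
have le_d x : -1 <= x <= 1 -> V x <= V x ^+ 2 + 4^-1.
  by move=> _; have := sqr_ge0 (V x - 2^-1); nra.
have := increment_le (ltW le11) (fun x _ => dF x) (fun x _ => dG' x) le_d.
have := RF (- 2^-1); have := RF 2^-1.
have [-> [-> [-> ->]]] := halves; rewrite waveN /=.
have := GE _ _ le11; have : N ^+ 2 <= 1 by rewrite expr_le1// ltW.
lra.
Qed.

(** As V >= 0, enlarging [-1/2, 1/2] to [-1, 1] turns R 0 into at most 2 R(1/2). *)
Lemma wave_half_ge : R 0 / 2 <= R 2^-1.
Proof.
have [F dF FE] := avg_increment continuous_velocity.
have RF x : R x = F (x + 2^-1) - F (x - 2^-1) by rewrite -FE; case: wave.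
have V0 x : 0 <= V x by case: shapeV.
have F_le x y : x <= y -> F x <= F y.
  by move=> xy; apply: increment_ge0 xy (fun x _ => dF x) _.
have := RF (- 2^-1); have := RF 2^-1; have := RF 0.
have [-> [-> [-> ->]]] := halves; rewrite waveN add0r sub0r.
have h1 : F (- 1) <= F (- 2^-1) by apply: F_le; lra.
have h2 : F (2^-1) <= F 1 by apply: F_le; lra.
lra.
Qed.

(* For |x| <= 1/2 the averaging window around [x] contains [0, y] or [-y, 0]. *)
Lemma sigma_lower_bound y : 0 <= y -> y <= 2^-1 -> y * phi (R y) <= sigma * R 0.
Proof.
move=> y0 y2; have [P dP PE] := avg_increment continuous_phiR.
have phi0 x : 0 <= phi (R x).
  apply: le_trans (dPhi_ge m_gt1 (wave_ge0 x) (wave_lt1 x)).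
  by rewrite divr_ge0 ?wave_ge0//; have := m_gt1; lra.
have P_le x z : x <= z -> P x <= P z.
  by move=> xz; apply: increment_ge0 xz (fun x _ => dP x) _ => t _; exact: phi0.
have phi_ge t : `|t| <= y -> phi (R y) <= phi (R t).
  move=> ty; apply: dPhi_le => //; last exact: wave_lt1.
  have -> : R t = R `|t| by case: (ger0P t) => _; rewrite ?waveN.
  exact: wave_noninc.
have P_incr a : `|a| <= y -> `|a + y| <= y -> y * phi (R y) <= P (a + y) - P a.
  rewrite !ler_norml => /andP[? ?] /andP[? ?].
  have aay : a <= a + y by lra.
  have := increment_le aay (fun x _ => is_derive_linear (phi (R y)) x) (fun x _ => dP x).
  rewrite -mulrBr addrAC subrr add0r mulrC; apply => t ta /=.
  by apply: phi_ge; rewrite ler_norml; lra.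
have V_ge x : `|x| <= 2^-1 -> y * phi (R y) <= sigma * V x.
  rewrite ler_norml => /andP[xl xu]; rewrite velocity_avg PE.
  have [x0|x0] := leP 0 x.
    have h1 : P (x - 2^-1) <= P 0 by apply: P_le; lra.
    have h2 : P (0 + y) <= P (x + 2^-1) by apply: P_le; lra.
    have := P_incr 0; rewrite normr0 add0r ger0_norm// => /(_ y0 (lexx _)).
    by move: h2; rewrite add0r; lra.
  have h1 : P (x - 2^-1) <= P (- y) by apply: P_le; lra.
  have h2 : P (- y + y) <= P (x + 2^-1) by apply: P_le; lra.
  have := P_incr (- y); rewrite normrN (ger0_norm y0) => /(_ (lexx _)) h.
  have : `|- y + y| <= y by rewrite addNr normr0.
  by move=> /h; lra.
have [F dF FE] := avg_increment continuous_velocity.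
have h20 : - (2^-1 : K) <= 2^-1 by lra.
have := increment_le h20 (fun x _ => is_derive_linear (y * phi (R y)) x)
  (fun x _ => is_deriveZ sigma (dF x)).
have -> : R 0 = F (2^-1) - F (- 2^-1).
  by have -> : R 0 = avg V 0; [case: wave|rewrite FE add0r sub0r].
rewrite -!/(sigma * _) -!mulrBr opprK; have [-> _] := halves; rewrite mulr1; apply.
by move=> x xb; apply: V_ge; rewrite ler_norml.
Qed.

(** Take y = 1/2 in [sigma_lower_bound]: the left side is at least R 0 / (4 (m + 1)), and R 0
    cancels however small it is. *)
Lemma sigma_ge : (4 * (m + 1))^-1 <= sigma.
Proof.
have m1 := m_gt1; have R0 := wave0_gt0.
have h2 : (0 : K) <= 2^-1 by rewrite invr_ge0.
have := sigma_lower_bound h2 (lexx _).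
have := dPhi_ge m_gt1 (wave_ge0 2^-1) (wave_lt1 2^-1); rewrite -/phi => h3 h4.
have h5 : R 0 / 2 / (m + 1) <= R 2^-1 / (m + 1).
  by rewrite ler_pM2r ?wave_half_ge// invr_gt0; lra.
rewrite -(ler_pM2r R0); apply: le_trans h4.
have -> : (4 * (m + 1))^-1 * R 0 = 2^-1 * (R 0 / 2 / (m + 1)).
  by field; apply/eqP; lra.
by rewrite ler_pM2l ?invr_gt0// (le_trans h5).
Qed.

(** * The rescaled profile and its equation *)

Let eps := amplitude_gap R.
Let mu := scale m R sigma.
Let u := rescaled m R sigma.

Definition drescaled (x : K) : K :=
  - (mu / eps) * (V (mu * x + 2^-1) - V (mu * x - 2^-1)).

(** The chain rule produces the factor mu^2 / (eps sigma), which the definition of mu turns into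
    eps^(m+1). *)
Definition ddrescaled (x : K) : K :=
  eps `^ (m + 1) *
    (2 * phi (R (mu * x)) - phi (R (mu * x + 1)) - phi (R (mu * x - 1))).

Let eps_gt0 : 0 < eps := amplitude_gap_gt0.

Lemma scale_gt0 : 0 < mu.
Proof. by rewrite sqrtr_gt0 mulr_gt0 ?sigma_gt0 ?powR_gt0. Qed.

Lemma scale_sqr : mu ^+ 2 = sigma * eps `^ (m + 2).
Proof. by rewrite sqr_sqrtr// mulr_ge0 ?powR_ge0// ltW ?sigma_gt0. Qed.

Lemma is_derive_rescaled (x : K) : is_derive x 1 u (drescaled x).
Proof.
have h1 := is_derive_scale (is_derive_wave (mu * x)).
have h2 := is_deriveB (is_derive_cst (R 0) x 1) h1.
have -> : u = eps^-1 *: (cst (R 0) - (fun y => R (mu * y))).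
  by apply/funext => y; rewrite /u /rescaled mulrC.
apply: is_derive_eq (is_deriveZ eps^-1 h2) _.
by rewrite -[LHS]/(_ * _) /drescaled sub0r; ring.
Qed.

Lemma is_derive_drescaled (x : K) : is_derive x 1 drescaled (ddrescaled x).
Proof.
have h1 := is_derive_scale (is_derive2_wave (mu * x)).
apply: is_derive_eq (is_deriveZ (- (mu / eps)) h1) _.
rewrite -[LHS]/(_ * _) /ddrescaled.
have e1 : mu / eps * mu = eps `^ (m + 1) * sigma.
  rewrite mulrAC -expr2 scale_sqr -mulrA [RHS]mulrC; congr (sigma * _).
  rewrite -{2}[eps]powRr1 ?ltW// -powRB; last by rewrite lt0r_neq0 ?implybT.
  by congr powR; ring.
have s0 := lt0r_neq0 sigma_gt0.
rewrite mulrA mulNr e1 mulrA -mulNr mulfK//; ring.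
Qed.

Lemma rescaled0 : u 0 = 0.
Proof. by rewrite /u /rescaled mulr0 subrr mul0r. Qed.

Lemma rescaledN x : u (- x) = u x.
Proof. by rewrite /u /rescaled mulrN waveN. Qed.

Lemma drescaledN x : drescaled (- x) = - drescaled x.
Proof.
have VN y : V (- y) = V y by case: shapeV.
rewrite /drescaled mulrN.
have -> : - (mu * x) + 2^-1 = - (mu * x - 2^-1) by ring.
have -> : - (mu * x) - 2^-1 = - (mu * x + 2^-1) by ring.
by rewrite !VN; ring.
Qed.

Lemma ddrescaledN x : ddrescaled (- x) = ddrescaled x.
Proof.
rewrite /ddrescaled mulrN.
have -> : - (mu * x) + 1 = - (mu * x - 1) by ring.
have -> : - (mu * x) - 1 = - (mu * x + 1) by ring.
by rewrite !waveN; ring.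
Qed.

Lemma drescaled0 : drescaled 0 = 0.
Proof. by have := drescaledN 0; rewrite oppr0; lra. Qed.

Lemma rescaled_gapE x : 1 - R (mu * x) = eps * (1 + u x).
Proof.
rewrite mulrDr mulr1 /u /rescaled -/eps -/mu [eps * (_ / _)]mulrC divfK ?lt0r_neq0//.
by rewrite /eps /amplitude_gap; ring.
Qed.

(** Substituting 1 - R = eps (1 + u) makes the powers of eps cancel in the leading term; the
    constant 2 / (m + 1) comes from the -1 in Phi'. *)
Lemma ddrescaled_force x : ddrescaled x = force m (u x) -
  eps `^ (m + 1) * (2 / (m + 1) + phi (R (mu * x + 1)) + phi (R (mu * x - 1))).
Proof.
have m1 := m_gt1.
have u1 : 0 <= 1 + u x.
  by rewrite -(pmulr_rge0 _ eps_gt0) -rescaled_gapE subr_ge0 ltW// wave_lt1.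
rewrite /ddrescaled {1}/phi /dPhi rescaled_gapE powRM ?(ltW eps_gt0)//.
have e1 : eps `^ (m + 1) * eps `^ (- (m + 1)) = 1.
  by rewrite powRN divff// lt0r_neq0// powR_gt0.
rewrite /force; set A := eps `^ (m + 1) in e1 *; set B := eps `^ _ in e1 *.
set C := (1 + u x) `^ _.
have -> : A * (2 * ((B * C - 1) / (m + 1)) - phi (R (mu * x + 1)) - phi (R (mu * x - 1)))
  = (A * B) * (2 * C / (m + 1)) - A * (2 / (m + 1) + phi (R (mu * x + 1)) + phi (R (mu * x - 1))).
  by field; apply/eqP; lra.
by rewrite e1; field; apply/eqP; lra.
Qed.

Let X := 1 / (2 * mu).

Lemma window_le x : 0 <= x <= X -> 0 <= mu * x /\ mu * x <= 2^-1.
Proof.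
have mu0 := scale_gt0.
move=> /andP[x0 xX]; split; first by rewrite mulr_ge0// ltW.
apply: (@le_trans _ _ (mu * X)); first by rewrite ler_pM2l.
by rewrite /X le_eqVlt; apply/orP; left; apply/eqP; field; apply/eqP; lra.
Qed.

Lemma window_ge0 : 0 <= X.
Proof. by rewrite divr_ge0// mulr_ge0// ltW// scale_gt0. Qed.

Lemma ddrescaled_ge0 x : 0 <= x <= X -> 0 <= ddrescaled x.
Proof.
move=> /window_le[h0 h1]; rewrite mulr_ge0 ?powR_ge0//.
have : `|mu * x| <= 2^-1 by rewrite ger0_norm.
by move=> /wave_concave; lra.
Qed.

Lemma ddrescaled_bounds x : 0 <= x <= X ->
  force m (u x) - force_defect m * eps `^ (m + 1) <= ddrescaled x <= force m (u x).
Proof.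
have m1 := m_gt1.
move=> /window_le[h0 h1]; rewrite ddrescaled_force.
have A0 : 0 <= eps `^ (m + 1) by rewrite powR_ge0.
have aux y : 2^-1 <= `|y| -> 0 <= phi (R y) <= phi (3 / 4).
  move=> hy; apply/andP; split.
    apply: le_trans (dPhi_ge m_gt1 (wave_ge0 y) (wave_lt1 y)).
    by rewrite divr_ge0 ?wave_ge0//; lra.
  apply: dPhi_le => //; last by lra.
  by apply: le_trans wave_half_le; apply: wave_le_abs; rewrite ?invr_ge0.
have /andP[a0 a1] : 0 <= phi (R (mu * x + 1)) <= phi (3 / 4).
  by apply: aux; rewrite ger0_norm; lra.
have /andP[b0 b1] : 0 <= phi (R (mu * x - 1)) <= phi (3 / 4).
  by apply: aux; rewrite ler0_norm; lra.
have c0 : 0 <= 2 / (m + 1) by rewrite divr_ge0//; lra.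
rewrite lerD2l lerN2 gerDl oppr_le0 mulr_ge0 ?addr_ge0//.
rewrite andbT mulrC ler_wpM2r// /force_defect -/phi; lra.
Qed.

(** * Lower bounds on the scale and growth of the profile *)

Lemma defect_le : eps <= small_gap m ->
  force_defect m * eps `^ (m + 1) <= force m 2^-1 / 2.
Proof.
have m1 := m_gt1.
have e1 := amplitude_gap_lt1; rewrite -/eps in e1.
rewrite le_min => /andP[_ es].
have M0 := force_defect_gt0 m_gt1.
apply: (@le_trans _ _ (force_defect m * eps)).
  rewrite ler_pM2l//; apply: ge1r_powR; last lra.
  by rewrite eps_gt0 ltW.
rewrite mulrC -ler_pdivlMr//; apply: (le_trans es).
by rewrite le_eqVlt; apply/orP; left; apply/eqP; field; apply/eqP; lra.
Qed.

Lemma rescaled_small_gap x : eps <= small_gap m -> 0 <= x <= X ->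
  [/\ 0 <= u x, u x <= x ^+ 2 / 2 & force m 2^-1 / 4 * (1 + x) <= 1 + u x].
Proof.
move=> es; apply: (profile_lower_bound m_gt1 window_ge0 (du := drescaled) (ddu := ddrescaled)).
- by move=> y _; exact: is_derive_rescaled.
- by move=> y _; exact: is_derive_drescaled.
- exact: rescaled0.
- exact: drescaled0.
- exact: ddrescaled_ge0.
- move=> y /ddrescaled_bounds /andP[h1 h2]; rewrite h2 andbT.
  by apply: le_trans h1; rewrite lerD2l lerN2 defect_le.
Qed.

(** If mu <= 1/2, then u(1) <= 1/2 yields R(mu) >= 1 - 3/2 eps, and [sigma_lower_bound] at y = mu
    gives sigma >= mu c1 eps^-(m+1). Multiplying by eps^(m+2) produces mu^2 >= mu c1 eps. *)
Lemma scale_ge_small_gap : eps <= small_gap m -> small_gap_scale_rate m * eps <= mu.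
Proof.
have m1 := m_gt1.
move=> es; have mu0 := scale_gt0; have e0 : 0 < eps := eps_gt0.
have e3 : eps <= 3^-1 by move: es; rewrite le_min => /andP[].
set c1 := small_gap_scale_rate m.
have c10 : 0 < c1 by apply: small_gap_scale_rate_gt0.
have c12 : c1 <= 2^-1 by apply: small_gap_scale_rate_le.
have [mu2|mu2] := leP mu 2^-1; last first.
  apply: (@le_trans _ _ c1); last lra.
  by rewrite ler_piMr ?ltW//; lra.
have X1 : 0 <= (1 : K) <= X.
  apply/andP; split => //; rewrite /X ler_pdivlMr; last by rewrite mulr_gt0.
  by lra.
have [_ u1 _] := rescaled_small_gap es X1.
have R1 : 1 - 3 / 2 * eps <= R mu.
  have eu : eps * u 1 <= eps * (1 ^+ 2 / 2) by rewrite ler_wpM2l// ltW.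
  by have := rescaled_gapE 1; rewrite mulr1 mulrDr mulr1; move: eu; rewrite expr1n; lra.
have R1' : 1 - 3 / 2 * eps < 1 by lra.
have phi1 : c1 * eps `^ (- (m + 1)) <= phi (1 - 3 / 2 * eps).
  rewrite /phi /dPhi subKr powRM ?(ltW eps_gt0)//.
  rewrite /c1 /small_gap_scale_rate mulrAC ler_pM2r ?invr_gt0; last lra.
  (* Once the power is at least 2, half of it absorbs the -1 in [dPhi]; hence the factor 1/2 in the
     rate. *)
  suff : 2 <= (3 / 2 * eps) `^ (- (m + 1)).
    rewrite powRM ?(ltW eps_gt0)//.
    by move: (_ `^ _) (eps `^ _) => a b; lra.
  rewrite powRN -[leLHS]invrK lef_pV2 ?posrE ?invr_gt0 ?powR_gt0//; last lra.
  apply: (@le_trans _ _ (3 / 2 * eps)); last lra.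
  by apply: ge1r_powR; lra.
have phi2 : phi (1 - 3 / 2 * eps) <= phi (R mu) by apply: dPhi_le => //; exact: wave_lt1.
have sig := sigma_lower_bound (ltW mu0) mu2.
have s0 := sigma_gt0; have R01 := wave_lt1 0.
have h : mu * (c1 * eps `^ (- (m + 1))) <= sigma.
  apply: (@le_trans _ _ (mu * phi (R mu))).
    by rewrite ler_pM2l// (le_trans phi1).
  by rewrite (le_trans sig)// ler_piMr ?ltW.
have E0 : 0 < eps `^ (m + 2) by rewrite powR_gt0.
have := h; rewrite -(ler_pM2r E0) -scale_sqr expr2.
have -> : mu * (c1 * eps `^ (- (m + 1))) * eps `^ (m + 2) = mu * (c1 * eps).
  rewrite -!mulrA -powRD; last by rewrite lt0r_neq0 ?implybT.
  by rewrite (_ : - (m + 1) + (m + 2) = 1) ?powRr1 ?ltW//; ring.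
by rewrite ler_pM2l.
Qed.

Lemma scale_ge_large_gap : small_gap m < eps -> large_gap_scale m <= mu.
Proof.
have m1 := m_gt1.
move=> es; have s0 := small_gap_gt0 m_gt1.
rewrite /mu /scale -/eps ler_wsqrtr// mulrC.
apply: ler_pM; rewrite ?powR_ge0 ?invr_ge0 ?sigma_ge//.
  by rewrite mulr_ge0//; lra.
apply: ge0_ler_powR; rewrite ?nnegrE ?(ltW es) ?(ltW eps_gt0) ?(ltW s0)//; lra.
Qed.

Lemma scale_ge : scale_rate m * eps <= mu.
Proof.
have [es|es] := leP eps (small_gap m).
  apply: le_trans (scale_ge_small_gap es).
  by rewrite ler_wpM2r ?(ltW eps_gt0)// ge_min lexx.
apply: le_trans (scale_ge_large_gap es).
apply: (@le_trans _ _ (scale_rate m)).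
  by rewrite ler_piMr ?(ltW (scale_rate_gt0 m_gt1))// ltW// amplitude_gap_lt1.
by rewrite ge_min lexx orbT.
Qed.

Lemma rescaled_ge0 x : 0 <= x <= X -> 0 <= u x.
Proof.
move=> /window_le[h0 _]; apply: divr_ge0; last exact: ltW eps_gt0.
by rewrite subr_ge0 wave_le_max.
Qed.

Lemma rescaled_growth x : 0 <= x <= X -> growth_rate m * (1 + x) <= 1 + u x.
Proof.
move=> xX; have /andP[x0 xX'] := xX.
have x1 : 0 <= 1 + x by lra.
have [es|es] := leP eps (small_gap m).
  have [_ _] := rescaled_small_gap es xX; apply: le_trans.
  by rewrite ler_wpM2r// ge_min lexx.
have s0 := large_gap_scale_gt0 m_gt1.
have XL : X <= 1 / (2 * large_gap_scale m).
  rewrite /X !mul1r lef_pV2 ?posrE ?mulr_gt0 ?scale_gt0//.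
  by rewrite ler_pM2l// scale_ge_large_gap.
have L0 : 0 < 1 + 1 / (2 * large_gap_scale m).
  by rewrite addr_gt0// divr_gt0// mulr_gt0.
apply: (@le_trans _ _ ((1 + 1 / (2 * large_gap_scale m))^-1 * (1 + x))).
  by rewrite ler_wpM2r// ge_min lexx orbT.
(* With a bounded window, the rate was chosen so that the left side never exceeds 1. *)
apply: (@le_trans _ _ 1); last by rewrite lerDl rescaled_ge0.
by rewrite mulrC ler_pdivrMr// [leRHS]mul1r lerD2l; exact: le_trans XL.
Qed.

(** * Monotonicity, convexity and comparison with the limit profile *)

(** The tangent at x > 0, evaluated at 0, gives x u'(x) >= u(x) > 0, with strictness from
    [wave_lt_max]; evaluated at y it gives the strict increase. The point x = 0 is separate. *)
Lemma rescaled_strict_mono : {in (`[0, X] : set K) &, {homo u : x y / x < y}}.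
Proof.
move=> x y; rewrite !inE/= !in_itv/= => xX yX xy.
have /andP[x0 _] := xX; have y0 : 0 < y by exact: le_lt_trans xy.
have uy : 0 < u y.
  by rewrite divr_gt0 ?eps_gt0// subr_gt0 wave_lt_max// mulr_gt0 ?scale_gt0.
have z0 : 0 <= (0 : K) <= X by rewrite lexx window_ge0.
have tan := tangent_le (fun z _ => is_derive_rescaled z)
  (fun z _ => is_derive_drescaled z) ddrescaled_ge0.
have h1 := tan _ _ z0 xX; have h2 := tan _ _ yX xX.
rewrite rescaled0 in h1; have [x_0|xn0] := eqVneq x 0; first by rewrite x_0 rescaled0.
have xp : 0 < x by rewrite lt_def xn0.
have ux : 0 < u x.
  by rewrite divr_gt0 ?eps_gt0// subr_gt0 wave_lt_max// mulr_gt0 ?scale_gt0.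
have d0 : 0 < drescaled x.
  by rewrite -(pmulr_lgt0 _ xp); lra.
have : 0 < drescaled x * (y - x) by rewrite mulr_gt0// subr_gt0.
by lra.
Qed.

Lemma rescaled_convex : convex_function (`[0, X] : set K) u.
Proof.
exact: derive2_convex_function (fun z _ => is_derive_rescaled z)
  (fun z _ => is_derive_drescaled z) ddrescaled_ge0.
Qed.

Lemma rescaled_comparison (S : K -> K) : limit_ivp m S ->
  forall x, 0 <= x <= X ->
  [/\ `|u x - S x| <= error_constant m * eps `^ (m - 1),
      `|drescaled x - derive1 S x| <= error_constant m * eps `^ m
    & `|ddrescaled x - derive1 (derive1 S) x| <= error_constant m * eps `^ (m + 1)].
Proof.
have m1 := m_gt1; have e0 : 0 < eps := eps_gt0.
have M0 := force_defect_gt0 m_gt1.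
case=> dS ddS S_gt SE [S0 dS0] x xX.
have f_S z : derive1 (derive1 S) z = force m (S z) by rewrite SE.
have is_dS (z : K) : is_derive z 1 S (derive1 S z).
  by apply: DeriveDef (dS z) _; rewrite derive1E.
have is_ddS (z : K) : is_derive z 1 (derive1 S) (derive1 (derive1 S) z).
  by apply: DeriveDef (ddS z) _; rewrite derive1E.
have growthS z : 0 <= z <= X -> growth_rate m * (1 + z) <= 1 + S z.
  have ddS0 t : 0 <= t <= X -> 0 <= derive1 (derive1 S) t.
    by move=> _; rewrite f_S ltW// force_gt0.
  have ddS_bd t : 0 <= t <= X ->
      force m (S t) - force m 2^-1 / 2 <= derive1 (derive1 S) t <= force m (S t).
    move=> _; rewrite f_S lexx andbT gerBl divr_ge0// ltW//.
    exact: force_half_gt0.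
  (* The limit profile has zero defect, so its growth holds in both regimes. *)
  move=> zX; have [_ _] := profile_lower_bound m_gt1 window_ge0 (fun z _ => is_dS z)
    (fun z _ => is_ddS z) S0 dS0 ddS0 ddS_bd zX.
  apply: le_trans; rewrite ler_wpM2r ?ge_min ?lexx//.
  by case/andP: zX => z0 _; rewrite addr_ge0.
have eta0 : 0 <= force_defect m * eps `^ (m + 1).
  by rewrite mulr_ge0 ?powR_ge0// ltW.
have defect z : 0 <= z <= X ->
    `|ddrescaled z - force m (u z)| <= force_defect m * eps `^ (m + 1).
  move=> /ddrescaled_bounds/andP[h1 h2]; rewrite ler_norml; apply/andP; split; lra.
have u0S0 : u 0 = S 0 by rewrite rescaled0.
have du0dS0 : drescaled 0 = derive1 S 0 by rewrite drescaled0.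
have := profile_comparison m_gt1 window_ge0 (growth_rate_gt0 m_gt1) eta0
  (fun z _ => is_derive_rescaled z) (fun z _ => is_derive_drescaled z)
  (fun z _ => is_dS z) (fun z _ => is_ddS z) u0S0 du0dS0 rescaled_growth growthS
  defect (fun z _ => f_S z).
move=> /(_ x xX); rewrite -/(comparison_rate m).
set Q := comparison_rate m; set M := force_defect m; set D := window_constant m.
have Q0 : 0 <= Q by rewrite mulr_ge0 ?powR_ge0.
have D0 : 0 < D.
  by rewrite addr_gt0// divr_gt0// mulr_gt0// scale_rate_gt0.
(* Here 1 <= 1 / eps, and x <= 1 / (2 mu) with mu >= [scale_rate] eps. Each factor 1 + x in the
   comparison thus costs one power of eps. *)
have xD : 1 + x <= D / eps.
  rewrite /D /window_constant mulrDl lerD//.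
    by rewrite ler_pdivlMr// mul1r ltW// amplitude_gap_lt1.
  have /andP[_ /le_trans] := xX; apply.
  rewrite /X !mul1r -invfM lef_pV2 ?posrE ?mulr_gt0 ?scale_gt0 ?scale_rate_gt0//.
  by rewrite -mulrA ler_pM2l// scale_ge.
have x10 : 0 <= 1 + x by case/andP: xX => x0 _; rewrite addr_ge0.
have c3 : 0 <= (Q * expR Q + 1) * M.
  by rewrite mulr_ge0 ?(ltW M0)// addr_ge0// mulr_ge0// expR_ge0.
have c2 : 0 <= expR Q * M * D by rewrite !mulr_ge0 ?expR_ge0 ?(ltW M0) ?(ltW D0).
have c1 : 0 <= expR Q * M * D ^+ 2 by rewrite !mulr_ge0 ?expR_ge0 ?exprn_ge0 ?(ltW M0) ?(ltW D0).
have CE : error_constant m = expR Q * M * D ^+ 2 + expR Q * M * D + (Q * expR Q + 1) * M.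
  by [].
have pm : eps `^ (m + 1) / eps = eps `^ m.
  rewrite -{2}[eps]powRr1 ?(ltW e0)// -powRB; last by rewrite lt0r_neq0 ?implybT.
  by congr powR; ring.
have pm1 : eps `^ m / eps = eps `^ (m - 1).
  by rewrite -{2}[eps]powRr1 ?(ltW e0)// -powRB// lt0r_neq0 ?implybT.
case=> h1 h2 h3; split.
- apply: (le_trans h1).
  apply: (@le_trans _ _ (expR Q * (M * eps `^ (m + 1)) * (D / eps) ^+ 2)).
    apply: ler_wpM2l; first by rewrite mulr_ge0 ?expR_ge0.
    by apply: lerXn2r; rewrite ?nnegrE// divr_ge0// ltW.
  have -> : expR Q * (M * eps `^ (m + 1)) * (D / eps) ^+ 2 =
      expR Q * M * D ^+ 2 * eps `^ (m - 1).
    by rewrite -pm1 -pm; field; exact: lt0r_neq0.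
  rewrite ler_wpM2r ?powR_ge0// CE; lra.
- apply: (le_trans h2).
  apply: (@le_trans _ _ (expR Q * (M * eps `^ (m + 1)) * (D / eps))).
    by apply: ler_wpM2l => //; rewrite mulr_ge0 ?expR_ge0.
  have -> : expR Q * (M * eps `^ (m + 1)) * (D / eps) = expR Q * M * D * eps `^ m.
    by rewrite -pm; field; exact: lt0r_neq0.
  rewrite ler_wpM2r ?powR_ge0// CE; lra.
- apply: (le_trans h3); rewrite mulrA ler_wpM2r ?powR_ge0// CE; lra.
Qed.

Lemma derive1_rescaled : derive1 u = drescaled.
Proof.
by apply/funext => x; rewrite derive1E (@derive_val _ _ _ _ _ _ _ (is_derive_rescaled x)).
Qed.

Lemma derive1_drescaled : derive1 drescaled = ddrescaled.
Proof.
by apply/funext => x; rewrite derive1E (@derive_val _ _ _ _ _ _ _ (is_derive_drescaled x)).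
Qed.

Lemma rescaled_uniform_comparison (S : K -> K) : limit_ivp m S ->
  let J : set K := `[- X, X] in
  [/\ (sup_dist J u S <= (error_constant m * eps `^ (m - 1))%:E)%E,
      (sup_dist J (derive1 u) (derive1 S) <= (error_constant m * eps `^ m)%:E)%E
    & (sup_dist J (derive1 (derive1 u)) (derive1 (derive1 S)) <=
         (error_constant m * eps `^ (m + 1))%:E)%E].
Proof.
move=> Sivp; have [SNivp SN1 SN2] := limit_ivp_reflect Sivp.
rewrite /= derive1_rescaled derive1_drescaled.
have cmp x : x \in `[- X, X]%R ->
  [/\ `|u x - S x| <= error_constant m * eps `^ (m - 1),
      `|drescaled x - derive1 S x| <= error_constant m * eps `^ m
    & `|ddrescaled x - derive1 (derive1 S) x| <= error_constant m * eps `^ (m + 1)].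
  rewrite in_itv/= => /andP[Xx xX]; have [x0|x0] := leP 0 x.
    by apply: rescaled_comparison => //; rewrite x0.
  have NxX : 0 <= - x <= X by rewrite oppr_ge0 ltW//= lerNl.
  have := rescaled_comparison SNivp NxX.
  rewrite SN1 SN2 rescaledN drescaledN ddrescaledN opprK.
  by rewrite -opprD normrN.
split; apply: ub_ereal_sup => _ [x /cmp[? ? ?] <-]; by rewrite lee_fin.
Qed.

End Wave.

(** * Uniformity over the family: each wave is treated with N = 1 - d and the same constant *)

Theorem theorem7 (K : realType) (m : K) (m_gt1 : 1 < m)
    (V R : K -> K -> K) (sigma : K -> K)
    (VRsigma : high_energy_family m V R sigma)
    (S0 : K -> K) (S0_ivp : limit_ivp m S0) :
  let eps d := amplitude_gap (R d) in
  let mu d := scale m (R d) (sigma d) in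
  let S d := rescaled m (R d) (sigma d) in
  let I d : set K := `[0, 1 / (2 * mu d)] in
  let J d : set K := `[- (1 / (2 * mu d)), 1 / (2 * mu d)] in
  (forall d : K, 0 < d < 1 ->
    {in I d &, {homo S d : x y / x < y}} /\ convex_function (I d) (S d)) /\
  (exists C : K, forall d : K, 0 < d < 1 ->
    [/\ (sup_dist (J d) (S d) S0 <= (C * eps d `^ (m - 1))%:E)%E,
        (sup_dist (J d) (derive1 (S d)) (derive1 S0)
           <= (C * eps d `^ m)%:E)%E
      & (sup_dist (J d) (derive1 (derive1 (S d))) (derive1 (derive1 S0))
           <= (C * eps d `^ (m + 1))%:E)%E]).
Proof.
case: VRsigma => sw shape normV _ _ eps mu S I J.
have N_gt0 (d : K) : 0 < d < 1 -> 0 < 1 - d by lra.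
have N_le1 (d : K) : 0 < d < 1 -> 1 - d <= 1 by lra.
split=> [d d01|].
  have [sV sR] := shape _ d01.
  split; first exact: (rescaled_strict_mono m_gt1 (sw _ d01) sV sR (normV _ d01) (N_gt0 _ d01)).
  exact: (rescaled_convex m_gt1 (sw _ d01) sV sR).
exists (error_constant m) => d d01.
have [sV sR] := shape _ d01.
exact: (rescaled_uniform_comparison m_gt1 (sw _ d01) sV sR (normV _ d01)
  (N_gt0 _ d01) (N_le1 _ d01) S0_ivp).
Qed.
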